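(* For any subset $X\subseteq S^1$, we have $d_{\mathrm{GH}}(S^1,X)\ge \min\left\{d_{\mathrm{H}}(S^1,X),\ \tfrac{\pi}{3}\right\}$.
   Context: $S^1$ is the circle of circumference $2\pi$ with its geodesic (arc-length) metric, and $X$ carries the restricted metric. $d_{\mathrm{H}}$ is the Hausdorff distance between subsets of $S^1$ and $d_{\mathrm{GH}}$ is the Gromov--Hausdorff distance (one half of the infimum of distortions of correspondences). Infima over the empty set are $+\infty$ (relevant only if $X=\emptyset$). *)

(* Defs.v *)
From HB Require Import structures.
From mathcomp Require Import all_boot all_order all_algebra.
From mathcomp Require Import all_classical all_reals all_analysis.
From mathcomp Require Import lra.
Set Implicit Arguments.
Unset Strict Implicit.
Unset Printing Implicit Defensive.
Import Order.TTheory GRing.Theory Num.Theory.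
Import numFieldNormedType.Exports.
Local Open Scope classical_set_scope.
Local Open Scope ring_scope.

(* R / 2 pi Z, each class being represented by its element of [0, 2 pi[. *)
Record circle (R : realType) := Circle {
  angle : R ;
  angleP : 0 <= angle < 2 * pi }.

HB.instance Definition _ (R : realType) := [isSub for @angle R].
HB.instance Definition _ (R : realType) := [Choice of circle R by <:].

(* |s - t| and 2 pi - |s - t| are the lengths of the two arcs between s and t. *)
Definition arc_length (R : realType) (s t : circle R) : R :=
  Num.min `|angle s - angle t| (2 * pi - `|angle s - angle t|).

Section circle_metric.
Context (R : realType).
Implicit Types s t u : circle R.

Lemma arc_lengthxx s : arc_length s s = 0.
Proof.
by rewrite /arc_length subrr normr0 subr0 min_l// mulr_ge0// pi_ge0.
Qed.

Lemma arc_length_positivity s t : arc_length s t = 0 -> s = t.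
Proof.
move=> st; apply: val_inj => /=; move: (angleP s) (angleP t) st.
rewrite /arc_length minEle => /andP[s0 sp] /andP[t0 tp].
case: (ger0P (angle s - angle t)) => ?; case: ifP => _ ?; lra.
Qed.

Lemma arc_length_sym s t : arc_length s t = arc_length t s.
Proof. by rewrite /arc_length distrC. Qed.

Lemma arc_length_triangle t s u :
  arc_length s u <= arc_length s t + arc_length t u.
Proof.
move: (angleP s) (angleP t) (angleP u).
rewrite /arc_length => /andP[s0 sp] /andP[t0 tp] /andP[u0 up].
rewrite ge_min.
case: (leP `|angle s - angle t|) => ?; case: (leP `|angle t - angle u|) => ?;
apply/orP;
case: (ger0P (angle s - angle t)) => ?; case: (ger0P (angle t - angle u)) => ?;
case: (ger0P (angle s - angle u)) => ?; solve [left; lra | right; lra].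
Qed.

(* arc_length is the angle subtended by the points of the unit circle of the
   plane with polar angles s and t. *)
Lemma arc_length_acos s t : arc_length s t = acos (cos (angle s - angle t)).
Proof.
move: (angleP s) (angleP t) => /andP[s0 sp] /andP[t0 tp].
have d0 := normr_ge0 (angle s - angle t).
have dp : `|angle s - angle t| <= 2 * pi.
  by case: (ger0P (angle s - angle t)) => ?; lra.
rewrite -cos_norm /arc_length.
case: (leP `|angle s - angle t|) => h.
  by rewrite cosK// in_itv/=; apply/andP; split; lra.
have -> : cos `|angle s - angle t| = cos (2 * pi - `|angle s - angle t|).
  by rewrite -cosN -cosD2pi addrC mulr_natl.
by rewrite cosK// in_itv/=; apply/andP; split; lra.
Qed.

End circle_metric.

HB.instance Definition _ (R : realType) :=
  @isMetric.Build R (circle R) (@arc_length R) (@arc_lengthxx R)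
    (@arc_length_positivity R) (@arc_length_sym R) (@arc_length_triangle R).

Definition thickening (R : realType) (Z : metricType R) (A : set Z) (r : R) :
  set Z := \bigcup_(a in A) ball a r.

Definition hausdorff_dist (R : realType) (Z : metricType R) (A B : set Z) :
  \bar R :=
  ereal_inf [set r%:E | r in
    [set r : R | [/\ 0 <= r, A `<=` thickening B r & B `<=` thickening A r]]].

Definition correspondence (S T : Type) (A : set S) (B : set T)
  (C : set (S * T)) : Prop :=
  [/\ C `<=` A `*` B, A `<=` fst @` C & B `<=` snd @` C].

(* The maximum with 0 only matters when C is empty, as ereal_sup set0 = -oo. *)
Definition distortion (R : realType) (S T : metricType R) (C : set (S * T)) :
  \bar R :=
  maxe 0%E (ereal_sup
    [set `|mdist p.1 q.1 - mdist p.2 q.2|%:E | p in C & q in C]).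

(* Gromov-Hausdorff distance between A and B, each with the metric restricted
   from its ambient space. *)
Definition gromov_hausdorff_dist (R : realType) (S T : metricType R)
  (A : set S) (B : set T) : \bar R :=
  ((2^-1)%:E * ereal_inf [set distortion C | C in correspondence A B])%E.

(* Main.v *)
(* Let X avoid an arc of length 2 r and f : S^1 -> X have distortion
   D < min (2 r, 2 pi / 3). Measuring angles from the middle of the arc turns f
   into g : S^1 -> R with |g s - g t| >= d(s, t) - D, and with
   |g s - g t| <= d(s, t) + D for close s, t, since X lies in an arc of length
   2 pi - 2 r. Let s, t be close, with antipodes s', t'. If g s' < g s but
   g t < g t', then either g t < g t' < g s or g s' < g s < g t', so that one of
   the jumps from s to t and from s' to t' is made of two gaps of size about
   pi - D at least, which is more than D. So the sign of g s - g s' is the same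
   all along the circle, although s and s' play symmetric roles. *)
Require Import Defs.
From mathcomp Require Import all_boot all_order all_algebra.
From mathcomp Require Import all_classical all_reals all_analysis.
From mathcomp Require Import lra.
Set Implicit Arguments.
Unset Strict Implicit.
Unset Printing Implicit Defensive.
Import Order.TTheory GRing.Theory Num.Theory.
Import numFieldNormedType.Exports.
Local Open Scope classical_set_scope.
Local Open Scope ring_scope.

Section circle_lemmas.
Context (R : realType).
Implicit Types (s t z : circle R) (g : circle R -> R).

Fact antipode_subproof s :
  0 <= (if angle s < pi then angle s + pi else angle s - pi) < 2 * pi.
Proof. by move: (angleP s) => /andP[? ?]; case: ltP => ?; lra. Qed.

Definition antipode s : circle R := Circle (antipode_subproof s).

Lemma arc_length_antipode s : arc_length s (antipode s) = pi.
Proof.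
have := pi_gt0 R; rewrite /arc_length /=.
move: (angleP s) => /andP[? ?] ?; rewrite minEle.
by case: ltP => ?; case: ger0P => ?; case: ifP => ?; lra.
Qed.

Lemma antipodeK : involutive antipode.
Proof.
move=> s; apply: val_inj => /=.
move: (angleP s) => /andP[? ?].
by case: (ltP (angle s) pi) => ?; case: ltP => ?; lra.
Qed.

Lemma arc_length_antipodes s t :
  arc_length (antipode s) (antipode t) = arc_length s t.
Proof.
rewrite /arc_length /=; move: (angleP s) (angleP t) => /andP[? ?] /andP[? ?].
rewrite !minEle.
by do 2!case: ltP => ?; do 2!case: ger0P => ?; do 2!case: ifP => ?; lra.
Qed.

Lemma antipode_order_adjacent g (D e : R) s t :
  (forall s t, arc_length s t <= e -> `|g s - g t| <= D + arc_length s t) ->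
  (forall s t, arc_length s t - D <= `|g s - g t|) ->
  D + e < 2 * pi / 3 -> arc_length s t <= e ->
  g (antipode s) < g s -> g (antipode t) < g t.
Proof.
move=> gU gL De st ss; rewrite ltNge; apply/negP => tt.
have Ls := gL s (antipode s); have Lt := gL t (antipode t).
have Lst := gL s (antipode t).
have := arc_length_triangle s t (antipode t); rewrite (arc_length_sym t s).
have a0 : 0 <= arc_length s t := mdist_ge0 s t.
have Us := gU s t st.
have Us' : `|g (antipode s) - g (antipode t)| <= D + arc_length s t.
  by rewrite -arc_length_antipodes gU// arc_length_antipodes.
move: Ls Lt Lst Us Us'; rewrite !arc_length_antipode.
(* Put [a = arc_length s t]. The two gaps add up to at least [(pi - D) + (pi - a - D)], while the
   jump is at most [D + a]. Hence [2 * pi <= 3 * D + 2 * a], which contradicts [D + e < 2 * pi / 3]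
   as [a <= e]. *)
by do 5!case: ger0P => ?; lra.
Qed.

Lemma circle_line_distortion g (D e : R) : 0 < e ->
  (forall s t, arc_length s t <= e -> `|g s - g t| <= D + arc_length s t) ->
  (forall s t, arc_length s t - D <= `|g s - g t|) ->
  2 * pi / 3 <= D + e.
Proof.
move=> e0 gU gL; rewrite leNgt; apply/negP => De.
have pi0 := pi_gt0 R.
have adj s t : arc_length s t <= e ->
    (g (antipode s) < g s) = (g (antipode t) < g t).
  move=> st; apply/idP/idP; apply: antipode_order_adjacent gU gL De _ => //.
  by rewrite arc_length_sym.
(* [N] steps of length [d = pi / N <= e] lead from angle 0 to its antipode at angle [pi]. *)
pose N := Num.bound (pi / e).
have piN : pi < N%:R * e.
  by rewrite -ltr_pdivrMr//; apply: archi_boundP; rewrite divr_ge0 ?ltW.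
have N0 : (0 : R) < N%:R by rewrite -(pmulr_lgt0 _ e0) (lt_trans pi0).
pose d := (pi : R) / N%:R.
have d0 : 0 < d by rewrite divr_gt0.
have dN : N%:R * d = pi by rewrite mulrC divfK ?gt_eqF.
have de : d <= e by rewrite ler_pdivrMr// mulrC ltW.
have o0 : (0 : R) <= 0 < 2 * (pi : R) by lra.
pose o := Circle o0.
have walk k s : (k <= N)%N -> angle s = k%:R * d ->
    (g (antipode o) < g o) = (g (antipode s) < g s).
  elim: k s => [|k IHk] s kN sk.
    by suff -> : s = o by []; apply: val_inj; rewrite /= sk mul0r.
  have kd : k%:R * d + d = k.+1%:R * d by rewrite -natr1 mulrDl mul1r.
  have k0 : 0 <= k%:R * d by rewrite mulr_ge0// ltW.
  have tP : 0 <= k%:R * d < 2 * pi by move: (angleP s) => /andP[? ?]; lra.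
  rewrite (IHk (Circle tP) (ltnW kN) erefl); apply: adj.
  by rewrite /arc_length /= sk -kd ge_min; apply/orP; left; case: ger0P => ?; lra.
have := walk N (antipode o) (leqnn N).
rewrite antipodeK /= pi0 add0r dN => /(_ erefl).
(* Exchanging [o] and its antipode leaves the comparison unchanged, so [g] takes equal values there,
   although [gL] separates them by [pi - D > 0]. *)
have := gL o (antipode o); rewrite arc_length_antipode.
by case: ltgtP => // ->; rewrite subrr normr0; lra.
Qed.

Definition angle_from z s : R :=
  if angle z <= angle s then angle s - angle z else angle s - angle z + 2 * pi.

(** Moving the origin of angles to [z] is a rotation, hence an isometry. *)
Lemma arc_length_angle_from z s t :
  let a := `|angle_from z s - angle_from z t| in
  arc_length s t = Num.min a (2 * pi - a).
Proof.
rewrite /= /angle_from /arc_length !minEle.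
move: (angleP s) (angleP t) (angleP z) => /andP[? ?] /andP[? ?] /andP[? ?].
case: (leP (angle z) (angle s)) => ?; case: (leP (angle z) (angle t)) => ?;
by do 2!case: ger0P => ?; do 2!case: ifP => ?; lra.
Qed.

Lemma angle_from_far (r : R) z s : r <= arc_length s z ->
  r <= angle_from z s <= 2 * pi - r.
Proof.
rewrite /angle_from /arc_length minEle.
move: (angleP s) (angleP z) => /andP[? ?] /andP[? ?].
by case: (leP (angle z)) => ?; case: ger0P => ?; case: ifP => ? ?;
  apply/andP; split; lra.
Qed.

Lemma thickening_small_distortion (X : set (circle R)) (f : circle R -> circle R)
    (D r : R) :
  (forall s, X (f s)) ->
  (forall s t, `|arc_length s t - arc_length (f s) (f t)| <= D) ->
  D < 2 * pi / 3 -> D < 2 * r -> [set: circle R] `<=` thickening X r.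
Proof.
move=> fX fD Dpi Dr z _; apply: contrapT => zX.
have far s : r <= angle_from z (f s) <= 2 * pi - r.
  apply: angle_from_far; rewrite leNgt; apply/negP => fsz.
  by apply: zX; exists (f s); [exact: fX | exact: fsz].
(* Half of the smaller slack keeps both inequalities strict once [e] is added to [D]. *)
pose e := Num.min (2 * pi / 3 - D) (2 * r - D) / 2.
have [e0 e1 e2] : [/\ 0 < e, D + e < 2 * pi / 3 & D + e < 2 * r].
  by rewrite /e minEle; case: ifP => ?; split; lra.
have : 2 * pi / 3 <= D + e.
  (* For the upper bound: if the shorter arc from [f s] to [f t] passed through [z], its length
     would be at least [2 * r > D + e], too much when [s] and [t] are within [e]. *)
  apply: (@circle_line_distortion (angle_from z \o f)) => //= s t; [move=> st|];
  have /andP[? ?] := far s; have /andP[? ?] := far t; move: (fD s t);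
  rewrite (arc_length_angle_from z (f s) (f t)) ler_norml minEle;
  by case: ger0P => ?; case: ifP => ? /andP[? ?]; lra.
by rewrite leNgt e1.
Qed.

End circle_lemmas.

Theorem theorem3 (R : realType) (X : set (circle R)) :
  (Order.min (hausdorff_dist [set: circle R]%classic X) (pi / 3)%:E
    <= gromov_hausdorff_dist [set: circle R]%classic X)%E.
Proof.
rewrite /gromov_hausdorff_dist -lee_pdivrMl//.
apply/ereal_infP => _ [C [CX C1 C2] <-].
(* This rules out the value [-oo] in the case analysis below. *)
have : (0 <= distortion C)%E by rewrite /distortion le_max lexx.
have CD p q : C p -> C q ->
    (`|mdist p.1 q.1 - mdist p.2 q.2|%:E <= distortion C)%E.
  move=> Cp Cq; rewrite /distortion le_max; apply/orP; right.
  by apply: ereal_sup_ubound; exists p => //; exists q.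
case: (distortion C) CD => [D|_|//] CD; last by rewrite leey.
rewrite lee_fin => D0; rewrite lee_pdivrMl// -EFinM ge_min.
case: (leP (pi / 3) (2^-1 * D)) => Dpi; first by rewrite lee_fin Dpi orbT.
(* The margin [e] gives the strict [D < 2 * r] for [r = 2^-1 * D + e], and makes the balls nonempty
   even if [D = 0]. *)
apply/orP; left; apply/lee_addgt0Pr => e e0; rewrite -EFinD.
apply: ereal_inf_lbound; exists (2^-1 * D + e) => //; split; first by lra.
- have /choice[f fC] s : exists x, C (s, x).
    by have [] := C1 s I => -[? x] Cx /= <-; exists x.
  apply: (@thickening_small_distortion _ _ f D); [| | lra..].
  + by move=> s; case: (CX _ (fC s)).
  + by move=> s t; have := CD _ _ (fC s) (fC t); rewrite lee_fin.
- by move=> x _; exists x => //; apply: ballxx; lra.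
Qed.
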